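(* Consider any one of the two users of the uncoordinated two-user Gaussian multiple access channel with energy harvesting users, let $B>0$ be the number of bits this user has to send, and let $\mathcal T$ be this user's transmission-time minimization problem. If an online algorithm $A$ for $\mathcal T$ is $r_A$-competitive, then $r_A\ge1.356$.
   Context: All logarithms are base 2. Model. Two users send bits to a single destination over a Gaussian multiple access channel without exchanging any information; each user chooses its rate assuming that the other uses the same power, so a user transmitting with constant power $P$ for a duration $T$ uses energy $PT$ and sends $\frac T2\log(1+2P)$ bits, irrespective of the other user. The energy arrival sequences at the two users are unrelated. Hence each user faces the following single-user problem separately. Energy arrivals at a user. An energy arrival sequence $\boldsymbol\sigma$ is a finite or infinite sequence of pairs $(t_i,E_i)$, $i=0,1,2,\dots$, with $0=t_0<t_1<t_2<\cdots$ (with $t_i\to\infty$ if the sequence is infinite) and $E_i>0$: the user receives energy $E_i$ at time $t_i$. The sequence is arbitrary (no distribution is assumed). Transmission. All $B$ bits of the user are available at time $0$. The user uses a piecewise constant nonnegative transmit power $P(t)$, $t\ge0$, with finitely many changes on any bounded time interval. By time $t$ the number of bits sent is $B(t)=\int_0^t\frac12\log(1+2P(s))\,ds$ and the energy used is $E(t)=\int_0^tP(s)\,ds$. The power profile is feasible for $\boldsymbol\sigma$ if $E(t)\le\sum_{i:\,t_i\le t}E_i$ for all $t\ge0$. The completion time of a profile is the smallest $T$ with $B(T)\ge B$ ($+\infty$ if there is none). Problem $\mathcal T$. Minimize the completion time over feasible power profiles. $\mathcal T_O(\boldsymbol\sigma)$ denotes the minimum completion time over all power profiles feasible for $\boldsymbol\sigma$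 (the optimal offline algorithm, which knows all of $\boldsymbol\sigma$ in advance; $+\infty$ if no feasible profile completes). Online algorithms. A (deterministic) online algorithm $A$ assigns to each $\boldsymbol\sigma$ a feasible power profile causally: the power used at time $t$ depends only on the arrivals $(t_i,E_i)$ with $t_i\le t$ (so if two sequences have the same arrivals up to time $t$, the two power profiles agree on $[0,t]$). $\mathcal T_A(\boldsymbol\sigma)$ denotes its completion time on $\boldsymbol\sigma$. Competitiveness. $A$ is $r_A$-competitive if $\mathcal T_A(\boldsymbol\sigma)/\mathcal T_O(\boldsymbol\sigma)\le r_A$ for every energy arrival sequence $\boldsymbol\sigma$ with $\mathcal T_O(\boldsymbol\sigma)<\infty$. *)

(* Defs.v *)
From Stdlib Require Import Reals.
From Coquelicot Require Import Coquelicot.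
Open Scope R_scope.

Definition log2 (x : R) : R := ln x / ln 2.

(* [arr i = Some (t_i, E_i)] is the arrival with index [i]; [arr i = None]
   means that the sequence is finite and has no arrival with index [i].
   [arr_unbounded] is t_i -> oo for an infinite sequence and holds trivially
   for a finite one. *)
Record arrival_seq : Type := ArrivalSeq {
  arr :> nat -> option (R * R);
  arr_start : exists E, arr 0%nat = Some (0, E);
  arr_closed : forall i, arr i = None -> arr (S i) = None;
  arr_increasing : forall i t E t' E',
    arr i = Some (t, E) -> arr (S i) = Some (t', E') -> t < t';
  arr_energy_pos : forall i t E, arr i = Some (t, E) -> 0 < E;
  arr_unbounded : forall M : R, exists N : nat, forall i t E,
    (N <= i)%nat -> arr i = Some (t, E) -> M < t
}.

(* The sum of the E_i with t_i <= t. By [arr_unbounded] only finitely many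
   terms of the series are nonzero. *)
Definition harvested (sigma : arrival_seq) (t : R) : R :=
  Series (fun i => match sigma i with
                   | Some (ti, Ei) => if Rle_dec ti t then Ei else 0
                   | None => 0
                   end).

(* Only the values at times t >= 0 are meaningful. [IsStepFun] leaves the values
   at the finitely many switching times of [0, T] unconstrained. *)
Record power_profile : Type := PowerProfile {
  power :> R -> R;
  power_nonneg : forall t, 0 <= t -> 0 <= power t;
  power_step : forall T, 0 <= T -> inhabited (IsStepFun power 0 T)
}.

(* A user transmitting with power p assumes that the other user also transmits
   with power p, hence the factor 2. *)
Definition rate (p : R) : R := 1 / 2 * log2 (1 + 2 * p).

Definition bits_sent (P : power_profile) (t : R) : R :=
  RInt (fun s => rate (P s)) 0 t.

Definition energy_used (P : power_profile) (t : R) : R := RInt P 0 t.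

Definition feasible (sigma : arrival_seq) (P : power_profile) : Prop :=
  forall t, 0 <= t -> energy_used P t <= harvested sigma t.

(* The set is closed, since [bits_sent P] is continuous, so the infimum is its
   least element when it is nonempty, and p_infty when it is empty. *)
Definition completion_time (B : R) (P : power_profile) : Rbar :=
  Glb_Rbar (fun T => 0 <= T /\ B <= bits_sent P T).

(* The infimum is a minimum unless it is p_infty: the largest number of bits
   that a feasible profile can send by a deadline is attained and depends
   continuously on the deadline. *)
Definition offline_time (B : R) (sigma : arrival_seq) : Rbar :=
  Glb_Rbar (fun T => exists P : power_profile,
    feasible sigma P /\ completion_time B P = Finite T).

Definition same_arrivals_upto (t : R) (sigma sigma' : arrival_seq) : Prop :=
  forall i ti Ei, ti <= t -> (sigma i = Some (ti, Ei) <-> sigma' i = Some (ti, Ei)).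

Record online_algorithm : Type := OnlineAlgorithm {
  alg :> arrival_seq -> power_profile;
  alg_feasible : forall sigma, feasible sigma (alg sigma);
  alg_causal : forall t sigma sigma', 0 <= t ->
    same_arrivals_upto t sigma sigma' ->
    forall s, 0 <= s <= t -> alg sigma s = alg sigma' s
}.

(* For B > 0 the offline time is positive, so the quotient in [Rbar] is p_infty
   exactly when the algorithm does not complete. *)
Definition competitive (B : R) (A : online_algorithm) (r : R) : Prop :=
  forall sigma : arrival_seq,
    Rbar_lt (offline_time B sigma) p_infty ->
    Rbar_le (Rbar_div (completion_time B (A sigma)) (offline_time B sigma)) (Finite r).

(* Main.v *)
(** The adversary uses two arrival sequences that agree before a time [t1]: a
    single arrival at time 0 whose energy barely suffices to send [B] bits, so
    that a slow constant power is optimal, and the same arrival followed by a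
    second one at [t1], well before the slow transmission would end.  In the
    second case it is optimal to exhaust the first arrival by [t1] and to finish
    shortly afterwards.  An online algorithm has used the same energy [e] by time
    [t1] in both cases.  Concavity of the rate shows that it finishes the first
    sequence within 1.356 times the offline optimum only if [e] is small, and
    the second one only if [e] is large. *)

Require Import Defs.
From Stdlib Require Import Reals Lra Lia List.
From Coquelicot Require Import Coquelicot.
Open Scope R_scope.

(** * Logarithms *)

Lemma ln_le_sub1 (y : R) : 0 < y -> ln y <= y - 1.
Proof.
  intros Hy. generalize (exp_ineq1_le (ln y)). rewrite exp_ln by assumption. lra.
Qed.

(** Since ln x <= n ln y and ln y <= y - 1, a numerical bound on a logarithm becomes a rational
    inequality between powers. It is sharp when y is close to the n-th root of x. *)
Lemma ln_le_of_le_pow (n : nat) (x y : R) :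
  0 < x -> 0 < y -> x <= y ^ n -> ln x <= INR n * (y - 1).
Proof.
  intros Hx Hy Hxy. apply Rle_trans with (ln (y ^ n)).
  - now apply ln_le.
  - rewrite ln_pow by assumption.
    apply Rmult_le_compat_l; [apply pos_INR | now apply ln_le_sub1].
Qed.

Lemma ln_ge_of_pow_le (n : nat) (x y : R) :
  0 < y -> y ^ n <= x -> INR n * (1 - / y) <= ln x.
Proof.
  intros Hy Hxy. apply Rle_trans with (ln (y ^ n)).
  - rewrite ln_pow by assumption.
    apply Rmult_le_compat_l; [apply pos_INR |].
    generalize (ln_le_sub1 (/ y) (Rinv_0_lt_compat _ Hy)).
    rewrite ln_Rinv by assumption. lra.
  - apply ln_le; [now apply pow_lt | assumption].
Qed.

Lemma ln2_pos : 0 < ln 2.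
Proof. generalize ln_lt_2; lra. Qed.

Lemma ln2_ge : 69 / 100 <= ln 2.
Proof.
  apply Rle_trans with (INR 128 * (1 - / (100542 / 100000))).
  - rewrite INR_IZR_INZ; simpl; lra.
  - apply ln_ge_of_pow_le; [| simpl]; lra.
Qed.

Lemma ln3_ge : 109 / 100 <= ln 3.
Proof.
  apply Rle_trans with (INR 203 * (1 - / (100542 / 100000))).
  - rewrite INR_IZR_INZ; simpl; lra.
  - apply ln_ge_of_pow_le; [| simpl]; lra.
Qed.

Lemma ln3_le : ln 3 <= 111 / 100.
Proof.
  apply Rle_trans with (INR 64 * (1 + 111 / 6400 - 1)).
  - apply ln_le_of_le_pow; [| | simpl]; lra.
  - rewrite INR_IZR_INZ; simpl; lra.
Qed.

Lemma ln_5_4_le : ln (5 / 4) <= 225 / 1000.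
Proof.
  apply Rle_trans with (INR 16 * (1 + 225 / 16000 - 1)).
  - apply ln_le_of_le_pow; [| | simpl]; lra.
  - rewrite INR_IZR_INZ; simpl; lra.
Qed.

Lemma ln_103_100_ge : 294 / 10000 <= ln (103 / 100).
Proof.
  apply Rle_trans with (INR 4 * (1 - / (100741 / 100000))).
  - rewrite INR_IZR_INZ; simpl; lra.
  - apply ln_ge_of_pow_le; [| simpl]; lra.
Qed.

(** * Step functions *)

Lemma ex_RInt_IsStepFun (f : R -> R) (a b : R) : IsStepFun f a b -> ex_RInt f a b.
Proof.
  intros Hf. apply ex_RInt_Reals_1. intros eps.
  exists (mkStepFun Hf), (mkStepFun (StepFun_P4 a b 0)). split.
  - intros t _. simpl. unfold fct_cte. rewrite Rminus_diag, Rabs_R0. lra.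
  - rewrite StepFun_P18, Rmult_0_l, Rabs_R0. apply cond_pos.
Qed.

Lemma IsStepFun_comp (g f : R -> R) (a b : R) :
  IsStepFun f a b -> IsStepFun (fun s => g (f s)) a b.
Proof.
  intros [l [lf (Hord & H0 & Hlast & Hlen & Hconst)]].
  exists l, (map g lf). repeat split; try assumption.
  - now rewrite length_map.
  - intros i Hi x Hx. rewrite RList.RList_P12 by lia.
    f_equal. now apply Hconst.
Qed.

(** The endpoints stay free, so half-open pieces can be glued whatever the values at the switching
    times. *)
Lemma IsStepFun_open_const (f : R -> R) (a b c : R) :
  a <= b -> (forall x, a < x < b -> f x = c) -> IsStepFun f a b.
Proof.
  intros Hab Hf. exists (a :: b :: nil), (c :: nil). repeat split.
  - intros i Hi. simpl in Hi. replace i with 0%nat by lia. exact Hab.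
  - simpl. now rewrite Rmin_left.
  - simpl. now rewrite Rmax_right.
  - intros i Hi x Hx. simpl in Hi. replace i with 0%nat in * by lia.
    now apply Hf.
Qed.

(** * Rates *)

Lemma rate_eq (p : R) : rate p = ln (1 + 2 * p) / (2 * ln 2).
Proof. unfold rate, log2. generalize ln2_pos; intro; field; lra. Qed.

Lemma rate_nonneg (p : R) : 0 <= p -> 0 <= rate p.
Proof.
  intros Hp. rewrite rate_eq. generalize ln2_pos; intro.
  apply Rdiv_le_0_compat; [| lra]. rewrite <- ln_1. apply ln_le; lra.
Qed.

(** Concavity: the logarithm lies below its tangent at 1 + 2p = x. Replacing ln x by an upper bound
    u keeps the coefficients rational up to the factor 2 ln 2. *)
Lemma rate_le_tangent (x u p : R) :
  0 < x -> ln x <= u -> 0 <= p ->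
  rate p <= (u - 1 + / x + 2 / x * p) / (2 * ln 2).
Proof.
  intros Hx Hu Hp. rewrite rate_eq. generalize ln2_pos; intro.
  apply Rmult_le_compat_r; [left; apply Rinv_0_lt_compat; lra |].
  assert (Hq : 0 < (1 + 2 * p) / x) by (apply Rdiv_lt_0_compat; lra).
  generalize (ln_le_sub1 _ Hq). rewrite ln_div by lra.
  replace ((1 + 2 * p) / x) with (/ x + 2 / x * p) by (field; lra). lra.
Qed.

Lemma ex_RInt_comp_power (P : power_profile) (g : R -> R) (a b : R) :
  0 <= a <= b -> ex_RInt (fun s => g (P s)) a b.
Proof.
  intros Hab. destruct (power_step P b) as [HP]; [lra |].
  apply (ex_RInt_Chasles_2 (V := R_CompleteNormedModule)) with 0; [exact Hab |].
  apply ex_RInt_IsStepFun. now apply (IsStepFun_comp g P).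
Qed.

Lemma ex_RInt_power (P : power_profile) (a b : R) :
  0 <= a <= b -> ex_RInt P a b.
Proof. apply (ex_RInt_comp_power P (fun p => p)). Qed.

Lemma ex_RInt_rate (P : power_profile) (a b : R) :
  0 <= a <= b -> ex_RInt (fun s => rate (P s)) a b.
Proof. apply (ex_RInt_comp_power P rate). Qed.

(** The tangent bound is affine in the power, so its integral depends on the profile only through
    the duration and the energy spent. The factor 2 ln 2 removes the base of the logarithm. *)
Lemma RInt_rate_le (P : power_profile) (a b x u : R) :
  0 <= a <= b -> 0 < x -> ln x <= u ->
  2 * ln 2 * RInt (fun s => rate (P s)) a b
    <= (b - a) * (u - 1 + / x) + 2 / x * RInt P a b.
Proof.
  intros Hab Hx Hu. generalize ln2_pos; intros HL.
  assert (Hle : RInt (fun s => rate (P s)) a b <=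
    RInt (fun s => (u - 1 + / x + 2 / x * P s) / (2 * ln 2)) a b).
  { apply RInt_le; [lra | now apply ex_RInt_rate | |].
    - now apply (ex_RInt_comp_power P (fun p => (u - 1 + / x + 2 / x * p) / (2 * ln 2))).
    - intros s Hs. apply rate_le_tangent; try assumption.
      apply power_nonneg. lra. }
  assert (Heq : is_RInt (fun s => (u - 1 + / x + 2 / x * P s) / (2 * ln 2)) a b
    (((b - a) * (u - 1 + / x) + 2 / x * RInt P a b) / (2 * ln 2))).
  { apply (is_RInt_ext (V := R_NormedModule))
      with (fun s => scal (/ (2 * ln 2)) (plus (u - 1 + / x) (scal (2 / x) (P s)))).
    { intros s _. unfold scal, plus; simpl. unfold mult; simpl. field. lra. }
    replace (((b - a) * (u - 1 + / x) + 2 / x * RInt P a b) / (2 * ln 2))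
      with (scal (/ (2 * ln 2))
              (plus (scal (b - a) (u - 1 + / x)) (scal (2 / x) (RInt P a b)))).
    2: { unfold scal, plus; simpl. unfold mult; simpl. field. lra. }
    apply (is_RInt_scal (V := R_NormedModule)).
    apply (is_RInt_plus (V := R_NormedModule)).
    - apply (is_RInt_const (V := R_NormedModule)).
    - apply (is_RInt_scal (V := R_NormedModule)).
      apply (RInt_correct (V := R_CompleteNormedModule)). now apply ex_RInt_power. }
  rewrite (is_RInt_unique _ _ _ _ Heq) in Hle.
  apply Rmult_le_compat_l with (r := 2 * ln 2) in Hle; [| lra].
  eapply Rle_trans; [exact Hle |]. right. field. lra.
Qed.

Lemma bits_sent_split (P : power_profile) (s t : R) :
  0 <= s <= t -> bits_sent P t = bits_sent P s + RInt (fun z => rate (P z)) s t.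
Proof.
  intros Hst. unfold bits_sent.
  rewrite <- (RInt_Chasles (V := R_CompleteNormedModule) _ 0 s t);
    [reflexivity | |]; apply ex_RInt_rate; lra.
Qed.

Lemma energy_used_split (P : power_profile) (s t : R) :
  0 <= s <= t -> energy_used P t = energy_used P s + RInt P s t.
Proof.
  intros Hst. unfold energy_used.
  rewrite <- (RInt_Chasles (V := R_CompleteNormedModule) _ 0 s t);
    [reflexivity | |]; apply ex_RInt_power; lra.
Qed.

Lemma bits_sent_incr (P : power_profile) (s t : R) :
  0 <= s <= t -> bits_sent P s <= bits_sent P t.
Proof.
  intros Hst. rewrite (bits_sent_split P s t Hst).
  assert (0 <= RInt (fun z => rate (P z)) s t); [| lra].
  apply RInt_ge_0; [lra | now apply ex_RInt_rate |].
  intros z Hz. apply rate_nonneg, power_nonneg. lra.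
Qed.

Lemma bits_sent_le (P : power_profile) (T x u : R) :
  0 <= T -> 0 < x -> ln x <= u ->
  2 * ln 2 * bits_sent P T <= T * (u - 1 + / x) + 2 / x * energy_used P T.
Proof.
  intros HT Hx Hu.
  generalize (RInt_rate_le P 0 T x u (conj (Rle_refl 0) HT) Hx Hu).
  now rewrite Rminus_0_r.
Qed.

(** * Completion times *)

Lemma completion_time_lb (B : R) (P : power_profile) (c : R) :
  (forall T, 0 <= T -> B <= bits_sent P T -> c <= T) ->
  Rbar_le c (completion_time B P).
Proof.
  intros H. apply Glb_Rbar_correct. intros T [HT HB]. now apply H.
Qed.

Lemma offline_time_le (B : R) (sigma : arrival_seq) (P : power_profile) (T : R) :
  feasible sigma P -> 0 <= T -> B <= bits_sent P T ->
  Rbar_le (offline_time B sigma) T.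
Proof.
  intros HP HT HB.
  assert (Hle : Rbar_le (completion_time B P) T).
  { apply Glb_Rbar_correct. now split. }
  (* Bounded on both sides, the completion time is finite, as a member of the set defining
     [offline_time] must be. *)
  assert (Hge : Rbar_le 0 (completion_time B P)).
  { now apply completion_time_lb. }
  apply Rbar_le_trans with (completion_time B P); [| exact Hle].
  destruct (completion_time B P) as [c | |] eqn:Hc; try contradiction.
  apply Glb_Rbar_correct. now exists P.
Qed.

(** Bounded energy cannot send B bits in arbitrarily short time. Positivity makes the competitive
    quotient meaningful. *)
Lemma offline_time_pos (B E : R) (sigma : arrival_seq) :
  0 < B -> (forall t, 0 <= t -> harvested sigma t <= E) ->
  Rbar_lt 0 (offline_time B sigma).
Proof.
  intros HB HE. generalize ln2_pos; intros HL.
  (* This x is so large that the energy term of the tangent bound covers at most half of 2 ln 2 B;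
     the other half must come from T ln x. *)
  set (x := 2 + 2 * Rabs E / (ln 2 * B)).
  assert (HLB : 0 < ln 2 * B) by now apply Rmult_lt_0_compat.
  assert (Hx : 2 <= x).
  { assert (0 <= 2 * Rabs E / (ln 2 * B)); [| unfold x; lra].
    apply Rdiv_le_0_compat; [generalize (Rabs_pos E); lra | assumption]. }
  assert (Hlx : 0 < ln x) by (rewrite <- ln_1; apply ln_increasing; lra).
  assert (HxE : 2 / x * Rabs E <= ln 2 * B).
  { apply Rmult_le_reg_l with x; [lra |].
    replace (x * (2 / x * Rabs E)) with (2 * Rabs E) by (field; lra).
    replace (x * (ln 2 * B)) with (2 * (ln 2 * B) + 2 * Rabs E)
      by (unfold x; field; lra).
    lra. }
  apply Rbar_lt_le_trans with (ln 2 * B / ln x).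
  { simpl. now apply Rdiv_lt_0_compat. }
  apply Glb_Rbar_correct. intros T [P [HP HT]].
  rewrite <- HT. apply completion_time_lb. clear T HT. intros T HT HBT.
  generalize (bits_sent_le P T x (ln x) HT ltac:(lra) (Rle_refl _)). intros Hbits.
  assert (Hen : 2 / x * energy_used P T <= 2 / x * Rabs E).
  { apply Rmult_le_compat_l; [apply Rdiv_le_0_compat; lra |].
    apply Rle_trans with E; [| apply Rle_abs].
    apply Rle_trans with (harvested sigma T); auto. }
  assert (Hinv : / x <= 1) by (rewrite <- Rinv_1; apply Rinv_le_contravar; lra).
  assert (HTx : T * (ln x - 1 + / x) <= T * ln x) by (apply Rmult_le_compat_l; lra).
  assert (2 * ln 2 * B <= 2 * ln 2 * bits_sent P T)
    by (apply Rmult_le_compat_l; lra).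
  apply Rmult_le_reg_r with (ln x); [assumption |].
  replace (ln 2 * B / ln x * ln x) with (ln 2 * B) by (field; lra). lra.
Qed.

(** The strict r < r' puts the completion time strictly below r' T, so some completing time precedes
    r' T whether or not the infimum is attained; monotonicity of the bits sent does the rest. *)
Lemma competitive_bits (B r r' T : R) (A : online_algorithm) (sigma : arrival_seq) :
  competitive B A r -> r < r' -> 0 < r' -> 0 <= T ->
  Rbar_lt 0 (offline_time B sigma) -> Rbar_le (offline_time B sigma) T ->
  B <= bits_sent (A sigma) (r' * T).
Proof.
  intros HA Hr Hr' HT H0 HleT. specialize (HA sigma).
  destruct (offline_time B sigma) as [o | |] eqn:Ho; try contradiction.
  simpl in H0, HleT. specialize (HA I).
  assert (Hio : 0 < / o) by now apply Rinv_0_lt_compat.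
  assert (Hc : Rbar_lt (completion_time B (A sigma)) (r' * T)).
  { destruct (completion_time B (A sigma)) as [c | |]; simpl in HA |- *.
    - apply Rmult_le_compat_r with (r := o) in HA; [| lra].
      rewrite Rmult_assoc, Rinv_l, Rmult_1_r in HA by lra.
      assert (r * o < r' * o) by (apply Rmult_lt_compat_r; lra).
      assert (r' * o <= r' * T) by (apply Rmult_le_compat_l; lra).
      lra.
    (* If the algorithm never completes, the quotient is [p_infty] because / o > 0, contradicting
       the bound r. *)
    - destruct (Rle_dec 0 (/ o)) as [Hle |]; [| lra].
      destruct (Rle_lt_or_eq_dec 0 (/ o) Hle); [contradiction | lra].
    - exact I. }
  apply Rnot_lt_le. intros Hlt. apply (Rbar_lt_not_le _ _ Hc).
  apply completion_time_lb. intros T' HT' HBT'.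
  apply Rnot_lt_le. intros HT'lt.
  generalize (bits_sent_incr (A sigma) T' (r' * T) (conj HT' (Rlt_le _ _ HT'lt))). lra.
Qed.

(** * Two-level power profiles *)

(** Both offline witnesses have this shape; a single constant power is the case u = v. *)
Definition two_level_power (p u q v t : R) : R :=
  if Rlt_dec t u then p else if Rlt_dec t v then q else 0.

Lemma two_level_power_1 (p u q v t : R) : t < u -> two_level_power p u q v t = p.
Proof. intros H. unfold two_level_power. destruct (Rlt_dec t u); [reflexivity | lra]. Qed.

Lemma two_level_power_2 (p u q v t : R) : u <= t < v -> two_level_power p u q v t = q.
Proof.
  intros H. unfold two_level_power.
  destruct (Rlt_dec t u); [lra |]. destruct (Rlt_dec t v); [reflexivity | lra].
Qed.

Lemma two_level_power_3 (p u q v t : R) :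
  u <= v <= t -> two_level_power p u q v t = 0.
Proof.
  intros H. unfold two_level_power.
  destruct (Rlt_dec t u); [lra |]. destruct (Rlt_dec t v); [lra | reflexivity].
Qed.

Lemma two_level_power_nonneg (p u q v t : R) :
  0 <= p -> 0 <= q -> 0 <= two_level_power p u q v t.
Proof.
  intros Hp Hq. unfold two_level_power.
  destruct (Rlt_dec t u); [lra |]. destruct (Rlt_dec t v); lra.
Qed.

Lemma two_level_power_step (p u q v T : R) :
  0 <= T -> 0 <= u <= v -> IsStepFun (two_level_power p u q v) 0 T.
Proof.
  intros HT Huv. destruct (Rle_dec T u).
  { apply IsStepFun_open_const with p; [lra |].
    intros; apply two_level_power_1; lra. }
  apply StepFun_P46 with u.
  { apply IsStepFun_open_const with p; [lra |].
    intros; apply two_level_power_1; lra. }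
  destruct (Rle_dec T v).
  { apply IsStepFun_open_const with q; [lra |].
    intros; apply two_level_power_2; lra. }
  apply StepFun_P46 with v.
  { apply IsStepFun_open_const with q; [lra |].
    intros; apply two_level_power_2; lra. }
  apply IsStepFun_open_const with 0; [lra |].
  intros; apply two_level_power_3; lra.
Qed.

Definition two_level (p u q v : R) (Hp : 0 <= p) (Hq : 0 <= q) (Huv : 0 <= u <= v) :
  power_profile :=
  PowerProfile (two_level_power p u q v)
    (fun t _ => two_level_power_nonneg p u q v t Hp Hq)
    (fun T HT => inhabits (two_level_power_step p u q v T HT Huv)).

Lemma RInt_open_const (f : R -> R) (a b c : R) :
  a <= b -> (forall x, a < x < b -> f x = c) -> RInt f a b = (b - a) * c.
Proof.
  intros Hab Hf. rewrite (RInt_ext (V := R_CompleteNormedModule) f (fun _ => c)).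
  - apply (RInt_const (V := R_CompleteNormedModule)).
  - intros x Hx. rewrite Rmin_left, Rmax_right in Hx by assumption. now apply Hf.
Qed.

Lemma two_level_bits (p u q v : R) (Hp : 0 <= p) (Hq : 0 <= q) (Huv : 0 <= u <= v) :
  bits_sent (two_level p u q v Hp Hq Huv) v = u * rate p + (v - u) * rate q.
Proof.
  rewrite (bits_sent_split _ u v Huv). unfold bits_sent.
  rewrite (RInt_open_const _ 0 u (rate p)), (RInt_open_const _ u v (rate q)); try lra.
  - intros x Hx. f_equal. apply two_level_power_2. lra.
  - intros x Hx. f_equal. apply two_level_power_1. lra.
Qed.

Lemma two_level_energy_1 (p u q v t : R) (Hp : 0 <= p) (Hq : 0 <= q)
    (Huv : 0 <= u <= v) :
  0 <= t <= u -> energy_used (two_level p u q v Hp Hq Huv) t = t * p.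
Proof.
  intros Ht. unfold energy_used. rewrite (RInt_open_const _ 0 t p); try lra.
  intros x Hx. apply two_level_power_1. lra.
Qed.

Lemma two_level_energy_le (p u q v t : R) (Hp : 0 <= p) (Hq : 0 <= q)
    (Huv : 0 <= u <= v) :
  0 <= t -> energy_used (two_level p u q v Hp Hq Huv) t <= u * p + (v - u) * q.
Proof.
  intros Ht.
  assert (Hvq : 0 <= (v - u) * q) by (apply Rmult_le_pos; lra).
  destruct (Rle_dec t u) as [Htu | Htu].
  { rewrite two_level_energy_1 by lra.
    assert (t * p <= u * p) by (apply Rmult_le_compat_r; lra). lra. }
  rewrite (energy_used_split _ u t) by lra. rewrite two_level_energy_1 by lra.
  apply Rplus_le_compat_l. destruct (Rle_dec t v) as [Htv | Htv].
  - rewrite (RInt_open_const _ u t q);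
      [apply Rmult_le_compat_r; lra | lra |].
    intros x Hx. apply two_level_power_2. lra.
  - rewrite <- (RInt_Chasles (V := R_CompleteNormedModule) _ u v t);
      try (apply ex_RInt_power; lra).
    rewrite (RInt_open_const _ u v q), (RInt_open_const _ v t 0); try lra.
    + unfold plus; simpl; lra.
    + intros x Hx. apply two_level_power_3. lra.
    + intros x Hx. apply two_level_power_2. lra.
Qed.

(** * Sequences with one or two arrivals *)

Definition one_arrival_fun (E : R) (i : nat) : option (R * R) :=
  match i with O => Some (0, E) | S _ => None end.

Definition two_arrivals_fun (E t E' : R) (i : nat) : option (R * R) :=
  match i with O => Some (0, E) | 1%nat => Some (t, E') | S (S _) => None end.

Definition one_arrival (E : R) (HE : 0 < E) : arrival_seq.
Proof.
  refine (ArrivalSeq (one_arrival_fun E) _ _ _ _ _).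
  - now exists E.
  - now intros [|i].
  - now intros [|i] t F t' F'.
  - intros [|i] t F; [| easy]. now intros [= <- <-].
  - intros M. exists 1%nat. intros [|i] t F; [lia | easy].
Defined.

Definition two_arrivals (E t E' : R) (HE : 0 < E) (Ht : 0 < t) (HE' : 0 < E') :
  arrival_seq.
Proof.
  refine (ArrivalSeq (two_arrivals_fun E t E') _ _ _ _ _).
  - now exists E.
  - now intros [|[|i]].
  - intros [|[|i]] s F s' F'; try easy. now intros [= <- <-] [= <- <-].
  - intros [|[|i]] s F; try easy; now intros [= <- <-].
  - intros M. exists 2%nat. intros [|[|i]] s F; [lia | lia | easy].
Defined.

(** The partial sums are constant from index n on. *)
Lemma Series_finite_support (a : nat -> R) (n : nat) :
  (forall i, (n < i)%nat -> a i = 0) -> Series a = sum_n a n.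
Proof.
  intros Ha. apply is_series_unique.
  apply (is_lim_seq_ext_loc (fun _ => sum_n a n) (sum_n a) (sum_n a n));
    [| apply is_lim_seq_const].
  exists n. intros m Hm. induction Hm as [| m Hm IH]; [reflexivity |].
  rewrite sum_Sn, <- IH, Ha by lia. unfold plus; simpl. lra.
Qed.

Lemma harvested_one_arrival (E t : R) (HE : 0 < E) :
  0 <= t -> harvested (one_arrival E HE) t = E.
Proof.
  intros Ht. unfold harvested. rewrite (Series_finite_support _ 0).
  - rewrite sum_O. simpl. destruct (Rle_dec 0 t); lra.
  - intros [|i] Hi; [lia | reflexivity].
Qed.

Lemma harvested_two_arrivals (E s E' t : R) (HE : 0 < E) (Hs : 0 < s) (HE' : 0 < E') :
  0 <= t ->
  harvested (two_arrivals E s E' HE Hs HE') t = if Rle_dec s t then E + E' else E.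
Proof.
  intros Ht. unfold harvested. rewrite (Series_finite_support _ 1).
  - rewrite sum_Sn, sum_O. unfold plus; simpl.
    destruct (Rle_dec 0 t); [| lra]. destruct (Rle_dec s t); lra.
  - intros [|[|i]] Hi; [lia | lia | reflexivity].
Qed.

Lemma same_arrivals_one_two (E s E' t : R) (HE : 0 < E) (Hs : 0 < s) (HE' : 0 < E') :
  t < s -> same_arrivals_upto t (one_arrival E HE) (two_arrivals E s E' HE Hs HE').
Proof.
  intros Hts [|[|i]] ti Ei Hti; simpl; split; try easy.
  intros [= <- <-]. lra.
Qed.

(** Causality equates the powers only strictly before s; a reaction at the instant s itself does not
    affect the integral. *)
Lemma energy_used_causal (A : online_algorithm) (E s E' : R)
    (HE : 0 < E) (Hs : 0 < s) (HE' : 0 < E') :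
  energy_used (A (two_arrivals E s E' HE Hs HE')) s
    = energy_used (A (one_arrival E HE)) s.
Proof.
  unfold energy_used. apply (RInt_ext (V := R_CompleteNormedModule)).
  intros t Ht. rewrite Rmin_left, Rmax_right in Ht by lra. symmetry.
  apply (alg_causal A t); [lra | now apply same_arrivals_one_two | lra].
Qed.

(** * Offline bounds and the two-sequence adversary *)

Lemma offline_one_arrival_le (B E p T : R) (HE : 0 < E) :
  0 <= p -> 0 <= T -> T * p <= E -> B <= T * rate p ->
  Rbar_le (offline_time B (one_arrival E HE)) T.
Proof.
  intros Hp HT HpE HB.
  apply offline_time_le
    with (two_level p T p T Hp Hp (conj HT (Rle_refl T))); [| exact HT |].
  - intros t Ht. rewrite harvested_one_arrival by assumption.
    eapply Rle_trans; [now apply two_level_energy_le | lra].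
  - rewrite two_level_bits. lra.
Qed.

Lemma offline_two_arrivals_le (B E s E' p q T : R)
    (HE : 0 < E) (Hs : 0 < s) (HE' : 0 < E') :
  0 <= p -> 0 <= q -> s <= T -> s * p <= E -> (T - s) * q <= E' ->
  B <= s * rate p + (T - s) * rate q ->
  Rbar_le (offline_time B (two_arrivals E s E' HE Hs HE')) T.
Proof.
  intros Hp Hq HT HpE HqE HB.
  apply offline_time_le
    with (two_level p s q T Hp Hq (conj (Rlt_le _ _ Hs) HT)); [| lra |].
  - intros t Ht. rewrite harvested_two_arrivals by assumption.
    destruct (Rle_dec s t) as [Hst | Hst].
    + eapply Rle_trans; [now apply two_level_energy_le | lra].
    + rewrite two_level_energy_1 by lra.
      apply Rle_trans with (s * p); [apply Rmult_le_compat_r; lra | assumption].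
  - now rewrite two_level_bits.
Qed.

Theorem theorem5 (B : R) (hB : 0 < B) (A : online_algorithm) (rA : R)
  (hA : competitive B A rA) : rA >= 1356 / 1000.
Proof.
  apply Rnot_lt_ge. intros Hr. generalize ln2_pos; intros HL.
  (* Unit of time and energy. With powers doubled and time measured in [k], 2.94
     nats are to be sent: slowly with power 0.03 in time 100, or with power 1 until
     time 3 and power 2 until time 3.8. *)
  set (k := 2 * ln 2 * B / (294 / 100)).
  assert (Hk : 0 < k).
  { apply Rdiv_lt_0_compat; [| lra].
    apply Rmult_lt_0_compat; [| assumption]. lra. }
  assert (HBk : 2 * ln 2 * B = 294 / 100 * k) by (unfold k; field).
  (* The first arrival pays for power 0.015 during 100 k or power 1/2 during 3 k; the second pays
     for power 1 from 3 k to 3.8 k. *)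
  assert (HE : 0 < 3 / 2 * k) by lra.
  assert (Hs : 0 < 3 * k) by lra.
  assert (HE' : 0 < 4 / 5 * k) by lra.
  set (sigma := one_arrival (3 / 2 * k) HE).
  set (sigma' := two_arrivals (3 / 2 * k) (3 * k) (4 / 5 * k) HE Hs HE').
  assert (Hoff : Rbar_le (offline_time B sigma) (100 * k)).
  { apply offline_one_arrival_le with (15 / 1000); try lra.
    apply Rmult_le_reg_l with (2 * ln 2); [lra |]. rewrite HBk, rate_eq.
    replace (1 + 2 * (15 / 1000)) with (103 / 100) by lra.
    replace (2 * ln 2 * (100 * k * (ln (103 / 100) / (2 * ln 2))))
      with (k * (100 * ln (103 / 100))) by (field; lra).
    rewrite Rmult_comm. apply Rmult_le_compat_l; [lra |].
    generalize ln_103_100_ge; lra. }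
  assert (Hoff' : Rbar_le (offline_time B sigma') (19 / 5 * k)).
  { apply offline_two_arrivals_le with (1 / 2) 1; try lra.
    apply Rmult_le_reg_l with (2 * ln 2); [lra |]. rewrite HBk, !rate_eq.
    replace (1 + 2 * (1 / 2)) with 2 by lra.
    replace (1 + 2 * 1) with 3 by lra.
    replace (2 * ln 2 * (3 * k * (ln 2 / (2 * ln 2))
                         + (19 / 5 * k - 3 * k) * (ln 3 / (2 * ln 2))))
      with (k * (3 * ln 2 + 4 / 5 * ln 3)) by (field; lra).
    rewrite Rmult_comm. apply Rmult_le_compat_l; [lra |].
    (* 3 * 0.69 + 0.8 * 1.09 = 2.942, just above 2.94. *)
    generalize ln2_ge ln3_ge; lra. }
  assert (Hpos : Rbar_lt 0 (offline_time B sigma)).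
  { apply offline_time_pos with (3 / 2 * k); [assumption |].
    intros t Ht. unfold sigma. rewrite harvested_one_arrival by assumption. lra. }
  assert (Hpos' : Rbar_lt 0 (offline_time B sigma')).
  { apply offline_time_pos with (3 / 2 * k + 4 / 5 * k); [assumption |].
    intros t Ht. unfold sigma'. rewrite harvested_two_arrivals by assumption.
    destruct (Rle_dec (3 * k) t); lra. }
  assert (Hbits := competitive_bits B rA (1356 / 1000) (100 * k) A sigma hA Hr
    ltac:(lra) ltac:(lra) Hpos Hoff).
  assert (Hbits' := competitive_bits B rA (1356 / 1000) (19 / 5 * k) A sigma' hA Hr
    ltac:(lra) ltac:(lra) Hpos' Hoff').
  assert (Hen := alg_feasible A sigma (1356 / 1000 * (100 * k)) ltac:(lra)).
  assert (Hen' := alg_feasible A sigma' (1356 / 1000 * (19 / 5 * k)) ltac:(lra)).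
  unfold sigma in Hen at 2. rewrite harvested_one_arrival in Hen by lra.
  unfold sigma' in Hen' at 2. rewrite harvested_two_arrivals in Hen' by lra.
  destruct (Rle_dec (3 * k) (1356 / 1000 * (19 / 5 * k))) as [_ |]; [| lra].
  rewrite (bits_sent_split _ (3 * k)) in Hbits by lra.
  rewrite (bits_sent_split _ (3 * k)) in Hbits' by lra.
  rewrite (energy_used_split _ (3 * k)) in Hen by lra.
  rewrite (energy_used_split _ (3 * k)) in Hen' by lra.
  unfold sigma' in Hen' at 1. rewrite energy_used_causal in Hen'. fold sigma in Hen'.
  (* The tangent at 5/4 touches at power 1/8, that is, energy 0.375 k by time 3 k, which lies
     between the two incompatible bounds derived at the end. *)
  generalize (bits_sent_le (A sigma) (3 * k) (5 / 4) (225 / 1000)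
    ltac:(lra) ltac:(lra) ln_5_4_le). intros H1.
  generalize (bits_sent_le (A sigma') (3 * k) (5 / 4) (225 / 1000)
    ltac:(lra) ltac:(lra) ln_5_4_le). intros H1'.
  unfold sigma' in H1' at 2. rewrite energy_used_causal in H1'. fold sigma in H1'.
  (* After 3 k, the tangent at 1 suits the tiny powers of the slow run and bounds its bits by energy
     alone; the tangent at 3 suits power 1 in the fast run. *)
  generalize (RInt_rate_le (A sigma) (3 * k) (1356 / 1000 * (100 * k)) 1 0
    ltac:(lra) ltac:(lra) ltac:(rewrite ln_1; lra)). intros H2.
  generalize (RInt_rate_le (A sigma') (3 * k) (1356 / 1000 * (19 / 5 * k)) 3 (111 / 100)
    ltac:(lra) ltac:(lra) ln3_le). intros H2'.
  apply Rmult_le_compat_l with (r := 2 * ln 2) in Hbits; [| lra].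
  apply Rmult_le_compat_l with (r := 2 * ln 2) in Hbits'; [| lra].
  rewrite HBk, Rmult_plus_distr_l in Hbits, Hbits'.
  (* Let e k be the common energy used by 3 k. The first sequence gives 2.94 <= 0.075 + 1.6 e + 2
     (1.5 - e), so e <= 0.3375. The second gives 2.94 <= 0.075 + 1.6 e + 0.9545 + (2/3) (2.3 - e),
     so e > 0.404. *)
  lra.
Qed.
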